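(* Let $\mathcal{M}$ be a rigid subcategory of $\mathcal{B}$ which contains all injective objects of $\mathcal{B}$. Then the functor $G:\mathcal{M}_R/[\overline{\Omega}\mathcal{M}]\to\operatorname{mod}\overline{\mathcal{M}}$ induced by $X\mapsto\overline{\operatorname{Hom}}_{\mathcal{B}}(-,X)|_{\overline{\mathcal{M}}}$ is an equivalence of categories.
   Context: $k$ is a field and $\mathcal{B}$ is a $k$-linear, Hom-finite, Krull-Schmidt exact category (in the sense of Quillen) with enough projectives and enough injectives. $\mathcal{I}$ denotes the full subcategory of injective objects. Subcategories are full and closed under isomorphisms and finite direct sums. $\mathcal{M}$ is rigid if $\operatorname{Ext}^1_{\mathcal{B}}(M,M')=0$ for all $M,M'\in\mathcal{M}$. For a subcategory $\mathcal{C}$, $[\mathcal{C}](X,Y)$ is the set of morphisms $X\to Y$ factoring through an object of $\mathcal{C}$, and the quotient of a category by $[\mathcal{C}]$ has the same objects and morphism spaces $\operatorname{Hom}(X,Y)/[\mathcal{C}](X,Y)$. Put $\overline{\operatorname{Hom}}_{\mathcal{B}}(X,Y)=\operatorname{Hom}_{\mathcal{B}}(X,Y)/[\mathcal{I}](X,Y)$ and let $\overline{\mathcal{M}}=\mathcal{M}/[\mathcal{I}]$ be the costable category of $\mathcal{M}$. For an additive $k$-linear category $\mathcal{D}$, $\operatorname{Mod}\mathcal{D}$ is the category of contravariant additive functors $\mathcal{D}\to\operatorname{mod}k$ (finite-dimensional vector spaces), and $\operatorname{mod}\mathcal{D}$ is its full subcategory of functors $A$ admitting an exact sequence $\operatorname{Hom}_{\mathcal{D}}(-,D_1)\to\operatorname{Hom}_{\mathcal{D}}(-,D_0)\to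 A\to 0$ with $D_0,D_1\in\mathcal{D}$. $\mathcal{M}_R$ is the full subcategory of objects $Y\in\mathcal{B}$ admitting a short exact sequence $0\to N_1\to N_0\to Y\to 0$ with $N_0,N_1\in\mathcal{M}$. $\overline{\Omega}\mathcal{M}$ is the full subcategory of objects $X\in\mathcal{B}$ for which there is a short exact sequence $0\to M\to I\to X\to 0$ with $M\in\mathcal{M}$ and $I\in\mathcal{I}$. The functor $K:\mathcal{M}_R\to\operatorname{Mod}\overline{\mathcal{M}}$, $KX=\overline{\operatorname{Hom}}_{\mathcal{B}}(-,X)|_{\overline{\mathcal{M}}}$, vanishes on $\overline{\Omega}\mathcal{M}$, so it factors through the projection $\mathcal{M}_R\to\mathcal{M}_R/[\overline{\Omega}\mathcal{M}]$ as a functor $G$; its values lie in $\operatorname{mod}\overline{\mathcal{M}}$. *)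

(* Defs.v *)
From HB Require Import structures.
From mathcomp Require Import all_boot all_algebra.
From mathcomp Require Import boolp.

Set Implicit Arguments.
Unset Strict Implicit.
Unset Printing Implicit Defensive.

Import GRing.Theory.
Local Open Scope ring_scope.
Local Open Scope quotient_scope.

Section QuotientSpace.
Variables (k : fieldType) (V : vectType k) (U : {vspace V}).

Definition quotv := Quotient.quot (U : zmodClosed V).

HB.instance Definition _ := GRing.Zmodule.on quotv.

Definition quotv_pi (v : V) : quotv := \pi_quotv v.

Lemma quotv_piE u v : (quotv_pi u = quotv_pi v) <-> (u - v \in U).
Proof. by rewrite Quotient.idealrBE; split=> [/eqP|/eqP]. Qed.

Lemma quotv_piK q : quotv_pi (repr q) = q.
Proof. exact: reprK. Qed.

Lemma quotv_piD u v : quotv_pi (u + v) = quotv_pi u + quotv_pi v.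
Proof. exact: (raddfD \pi_quotv). Qed.

Definition quotv_scale (a : k) (q : quotv) : quotv := quotv_pi (a *: repr q).

Lemma quotv_piZ a v : quotv_pi (a *: v) = quotv_scale a (quotv_pi v).
Proof.
apply/quotv_piE; rewrite -scalerBr memvZ //.
by apply/quotv_piE; rewrite quotv_piK.
Qed.

Lemma quotv_scaleA a b q :
  quotv_scale a (quotv_scale b q) = quotv_scale (a * b) q.
Proof. by rewrite -(quotv_piK q) -!quotv_piZ scalerA. Qed.

Lemma quotv_scale1 : left_id 1 quotv_scale.
Proof. by move=> q; rewrite -(quotv_piK q) -!quotv_piZ scale1r. Qed.

Lemma quotv_scaleDr : right_distributive quotv_scale +%R.
Proof.
move=> a p q; rewrite -(quotv_piK p) -(quotv_piK q).
by rewrite -quotv_piD -!quotv_piZ scalerDr quotv_piD.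
Qed.

Lemma quotv_scaleDl q : {morph quotv_scale^~ q : a b / a + b}.
Proof.
by move=> a b /=; rewrite -(quotv_piK q) -!quotv_piZ scalerDl quotv_piD.
Qed.

HB.instance Definition _ := GRing.Zmodule_isLmodule.Build k quotv
  quotv_scaleA quotv_scale1 quotv_scaleDr quotv_scaleDl.

Lemma quotv_pi_linear : linear quotv_pi.
Proof. by move=> a u v; rewrite quotv_piD quotv_piZ. Qed.

HB.instance Definition _ := GRing.isLinear.Build k V quotv _ quotv_pi
  quotv_pi_linear.

(* V/U is isomorphic to a complement of U in V *)
Definition to_compl (v : V) : V := v - projv U v.

Lemma to_compl_linear : linear to_compl.
Proof. by move=> a u v; rewrite /to_compl linearP scalerBr opprD addrACA. Qed.

HB.instance Definition _ := GRing.isLinear.Build k V V _ to_compl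
  to_compl_linear.

Lemma to_compl_eq0 v : v \in U -> to_compl v = 0.
Proof. by move=> vU; rewrite /to_compl projv_id // subrr. Qed.

Definition quotv_compl (q : quotv) : V := to_compl (repr q).

Lemma quotv_complE v : quotv_compl (quotv_pi v) = to_compl v.
Proof.
apply/eqP; rewrite -subr_eq0 -linearB /= to_compl_eq0 //.
by apply/quotv_piE; rewrite quotv_piK.
Qed.

Lemma quotv_compl_linear : linear quotv_compl.
Proof.
move=> a p q; rewrite -(quotv_piK p) -(quotv_piK q) -linearP !quotv_complE.
exact: linearP.
Qed.

Lemma quotv_vect_iso : Vector.axiom (\dim U^C) quotv.
Proof.
exists (fun q => \row_i coord (vbasis U^C) i (quotv_compl q)).
  by move=> a p q; apply/rowP=> i; rewrite !mxE quotv_compl_linear linearP.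
exists (fun rw : 'rV_(\dim U^C) =>
          quotv_pi (\sum_i rw 0 i *: (vbasis U^C)`_i)) => [q|rw].
  rewrite -[RHS]quotv_piK; apply/quotv_piE.
  under eq_bigr => i _ do rewrite mxE.
  rewrite -coord_vbasis ?memv_projC //.
  by rewrite /quotv_compl /to_compl addrAC subrr sub0r memvN memv_proj.
apply/rowP=> i; rewrite mxE quotv_complE.
set u := \sum_i _; have uC : u \in (U^C)%VS.
  by apply: rpred_sum => j _; rewrite rpredZ ?vbasis_mem ?memt_nth.
have /eqP pu0 : projv U u == 0 by rewrite -memv_ker lker_proj.
by rewrite /to_compl pu0 subr0 coord_sum_free ?(basis_free (vbasisP _)).
Qed.

HB.instance Definition _ := Lmodule_hasFinDim.Build k quotv quotv_vect_iso.

End QuotientSpace.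

Section PredSpace.
Variables (k : fieldType) (V : vectType k) (P : V -> Prop).
Hypotheses (P0 : P 0) (PP : forall a u v, P u -> P v -> P (a *: u + v)).

Lemma pred_vspace_exists : exists U : {vspace V}, forall v, v \in U <-> P v.
Proof.
pose Q n := `[< exists U : {vspace V}, \dim U = n /\ forall v, v \in U -> P v >].
have exQ : exists n, Q n.
  exists 0%N; apply/asboolP; exists 0%VS; split; first exact: dimv0.
  by move=> v; rewrite memv0 => /eqP ->.
have bQ n : Q n -> (n <= \dim {: V})%N.
  by move=> /asboolP[U [<- _]]; rewrite dimvS ?subvf.
case: (ex_maxnP exQ bQ) => n /asboolP[U [dU UP]] maxn.
exists U => v; split=> [/UP//|Pv].
have leqn : (\dim (U + <[v]>)%VS <= \dim U)%N.
  rewrite dU; apply: maxn; apply/asboolP; exists (U + <[v]>)%VS; split=> // w.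
  case/memv_addP=> u uU [_ /vlineP[a ->] ->].
  by rewrite addrC; apply: PP => //; apply: UP.
have /eqP -> : U == (U + <[v]>)%VS.
  by rewrite eqEdim addvSl leqn.
by apply: (subvP (addvSr _ _)); apply: memv_line.
Qed.

Definition pred_vspace : {vspace V} := sval (cid pred_vspace_exists).

Lemma mem_pred_vspace v : v \in pred_vspace <-> P v.
Proof. exact: (svalP (cid pred_vspace_exists)). Qed.

End PredSpace.

Record category := Category {
  ob :> Type;
  hom : ob -> ob -> Type;
  idm : forall X, hom X X;
  comp : forall X Y Z, hom Y Z -> hom X Y -> hom X Z;
  compA : forall X Y Z T (h : hom Z T) (g : hom Y Z) (f : hom X Y),
    comp h (comp g f) = comp (comp h g) f;
  comp1m : forall X Y (f : hom X Y), comp (idm Y) f = f;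
  compm1 : forall X Y (f : hom X Y), comp f (idm X) = f }.

Arguments hom {c} _ _.
Arguments idm {c} _.
Arguments comp {c X Y Z} _ _.

Definition op (C : category) : category :=
  @Category C (fun X Y => @hom C Y X) (@idm C)
    (fun X Y Z g f => comp f g)
    (fun X Y Z T h g f => esym (compA f g h))
    (fun X Y f => compm1 f) (fun X Y f => comp1m f).

Record functor (C D : category) := Functor {
  fobj :> C -> D;
  fmap : forall X Y, hom X Y -> hom (fobj X) (fobj Y);
  fmap1 : forall X, fmap (idm X) = idm (fobj X);
  fmapM : forall X Y Z (g : hom Y Z) (f : hom X Y),
    fmap (comp g f) = comp (fmap g) (fmap f) }.

Arguments fmap {C D} _ [X Y] _.

Definition idF (C : category) : functor C C :=
  @Functor C C id (fun _ _ f => f) (fun _ => erefl) (fun _ _ _ _ _ => erefl).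

Section FunctorOperations.
Variables C D E : category.

Lemma compF1 (G : functor D E) (F : functor C D) X :
  fmap G (fmap F (idm X)) = idm (G (F X)).
Proof. by rewrite !fmap1. Qed.

Lemma compFM (G : functor D E) (F : functor C D) X Y Z
    (g : hom Y Z) (f : hom X Y) :
  fmap G (fmap F (comp g f)) = comp (fmap G (fmap F g)) (fmap G (fmap F f)).
Proof. by rewrite !fmapM. Qed.

Definition compF (G : functor D E) (F : functor C D) : functor C E :=
  @Functor C E (fun X => G (F X)) (fun X Y f => fmap G (fmap F f))
    (compF1 G F) (compFM G F).

Definition opF (F : functor C D) : functor (op C) (op D) :=
  @Functor (op C) (op D) F (fun X Y f => fmap F f)
    (@fmap1 _ _ F) (fun X Y Z g f => fmapM F f g).

End FunctorOperations.

Section NatTrans.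
Variables C D : category.

Record nattrans (F G : functor C D) := NatTrans {
  ntc :> forall X, hom (F X) (G X);
  ntP : forall X Y (f : hom X Y),
    comp (ntc Y) (fmap F f) = comp (fmap G f) (ntc X) }.

Lemma nattrans_eq F G (s t : nattrans F G) : (forall X, s X = t X) -> s = t.
Proof.
case: s t => [s sP] [t tP] /= st.
have {}st : s = t by apply: functional_extensionality_dep.
by case: _ / st tP => tP; congr NatTrans; apply: Prop_irrelevance.
Qed.

Lemma idnt_subproof (F : functor C D) X Y (f : hom X Y) :
  comp (idm (F Y)) (fmap F f) = comp (fmap F f) (idm (F X)).
Proof. by rewrite comp1m compm1. Qed.

Definition idnt F : nattrans F F := NatTrans (@idnt_subproof F).

Lemma compnt_subproof F G H (t : nattrans G H) (s : nattrans F G)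
    X Y (f : hom X Y) :
  comp (comp (t Y) (s Y)) (fmap F f) = comp (fmap H f) (comp (t X) (s X)).
Proof. by rewrite -compA ntP compA ntP compA. Qed.

Definition compnt F G H (t : nattrans G H) (s : nattrans F G) : nattrans F H :=
  NatTrans (compnt_subproof t s).

Definition funcat : category.
Proof.
refine (@Category (functor C D) nattrans idnt compnt _ _ _).
- by move=> *; apply: nattrans_eq => x; apply: compA.
- by move=> *; apply: nattrans_eq => x; apply: comp1m.
- by move=> *; apply: nattrans_eq => x; apply: compm1.
Defined.

End NatTrans.

Definition isomorphism (C : category) (X Y : C) (f : hom X Y) : Prop :=
  exists g : hom Y X, comp g f = idm X /\ comp f g = idm Y.

Definition full (C : category) (P : C -> Prop) : category :=
  @Category {X : C | P X} (fun X Y => hom (sval X) (sval Y))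
    (fun X => idm (sval X)) (fun X Y Z g f => comp g f)
    (fun X Y Z T h g f => compA h g f)
    (fun X Y f => comp1m f) (fun X Y f => compm1 f).

Definition is_equivalence (C D : category) (F : functor C D) : Prop :=
  exists G : functor D C,
    (exists eta : nattrans (idF C) (compF G F),
       forall X, isomorphism (eta X)) /\
    (exists eps : nattrans (compF F G) (idF D),
       forall Y, isomorphism (eps Y)).

(* Since the morphism spaces are vectTypes, these categories are Hom-finite. *)
Record lincat (k : fieldType) := LinCat {
  lob :> Type;
  lhom : lob -> lob -> vectType k;
  lid : forall X, lhom X X;
  lcomp : forall X Y Z, lhom Y Z -> lhom X Y -> lhom X Z;
  lcompA : forall X Y Z T (h : lhom Z T) (g : lhom Y Z) (f : lhom X Y),
    lcomp h (lcomp g f) = lcomp (lcomp h g) f;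
  lcomp1m : forall X Y (f : lhom X Y), lcomp (lid Y) f = f;
  lcompm1 : forall X Y (f : lhom X Y), lcomp f (lid X) = f;
  lcomp_linl : forall X Y Z (f : lhom X Y),
    linear (fun g : lhom Y Z => lcomp g f);
  lcomp_linr : forall X Y Z (g : lhom Y Z),
    linear (fun f : lhom X Y => lcomp g f) }.

Arguments lhom {k l} _ _.
Arguments lid {k l} _.
Arguments lcomp {k l X Y Z} _ _.

Notation "g \oc f" := (lcomp g f) (at level 40, left associativity).

Coercion cat_of (k : fieldType) (L : lincat k) : category :=
  @Category L (fun X Y => @lhom k L X Y) (@lid k L)
    (@lcomp k L) (@lcompA k L) (@lcomp1m k L) (@lcompm1 k L).

Section LinCatTheory.
Variables (k : fieldType) (L : lincat k).
Implicit Types X Y Z W : L.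

Lemma lcompDl X Y Z (g g' : lhom Y Z) (f : lhom X Y) :
  (g + g') \oc f = g \oc f + g' \oc f.
Proof. by have := lcomp_linl f 1 g g'; rewrite !scale1r. Qed.

Lemma lcompDr X Y Z (g : lhom Y Z) (f f' : lhom X Y) :
  g \oc (f + f') = g \oc f + g \oc f'.
Proof. by have := lcomp_linr g 1 f f'; rewrite !scale1r. Qed.

Lemma lcomp0m X Y Z (f : lhom X Y) : (0 : lhom Y Z) \oc f = 0.
Proof. by apply: (addIr (0 \oc f)); rewrite -lcompDl !add0r. Qed.

Lemma lcompm0 X Y Z (g : lhom Y Z) : g \oc (0 : lhom X Y) = 0.
Proof. by apply: (addIr (g \oc 0)); rewrite -lcompDr !add0r. Qed.

Lemma lcompZl X Y Z a (g : lhom Y Z) (f : lhom X Y) :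
  (a *: g) \oc f = a *: (g \oc f).
Proof. by have := lcomp_linl f a g 0; rewrite lcomp0m !addr0. Qed.

Lemma lcompZr X Y Z a (g : lhom Y Z) (f : lhom X Y) :
  g \oc (a *: f) = a *: (g \oc f).
Proof. by have := lcomp_linr g a f 0; rewrite lcompm0 !addr0. Qed.

Lemma lcompNl X Y Z (g : lhom Y Z) (f : lhom X Y) : (- g) \oc f = - (g \oc f).
Proof. by rewrite -scaleN1r lcompZl scaleN1r. Qed.

Lemma lcompNr X Y Z (g : lhom Y Z) (f : lhom X Y) : g \oc (- f) = - (g \oc f).
Proof. by rewrite -scaleN1r lcompZr scaleN1r. Qed.

Lemma lcompBl X Y Z (g g' : lhom Y Z) (f : lhom X Y) :
  (g - g') \oc f = g \oc f - g' \oc f.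
Proof. by rewrite lcompDl lcompNl. Qed.

Lemma lcompBr X Y Z (g : lhom Y Z) (f f' : lhom X Y) :
  g \oc (f - f') = g \oc f - g \oc f'.
Proof. by rewrite lcompDr lcompNr. Qed.

Definition is_iso X Y (f : lhom X Y) : Prop := @isomorphism L X Y f.

Definition is_zero Z : Prop :=
  forall X, (forall f : lhom X Z, f = 0) /\ (forall f : lhom Z X, f = 0).

Record biproduct X Y W := Biproduct {
  bin1 : lhom X W; bin2 : lhom Y W; bpr1 : lhom W X; bpr2 : lhom W Y;
  bpr1_in1 : bpr1 \oc bin1 = lid X;
  bpr2_in2 : bpr2 \oc bin2 = lid Y;
  bpr2_in1 : bpr2 \oc bin1 = 0;
  bpr1_in2 : bpr1 \oc bin2 = 0;
  bin_pr : bin1 \oc bpr1 + bin2 \oc bpr2 = lid W }.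

Inductive direct_sum (P : L -> Prop) : L -> Prop :=
| direct_sum0 Z : is_zero Z -> direct_sum P Z
| direct_sumS X Y W : P X -> direct_sum P Y -> biproduct X Y W ->
    direct_sum P W.

(* The ring End(X) is local: it is nonzero and a sum of non-units is a non-unit
   (stated by contraposition). *)
Definition local_end X : Prop :=
  lid X <> 0 /\
  forall f g : lhom X X, is_iso (f + g) -> is_iso f \/ is_iso g.

Definition krull_schmidt : Prop := forall X, direct_sum local_end X.

End LinCatTheory.

Record addcat (k : fieldType) := AddCat {
  add_lincat :> lincat k;
  add_zero : exists Z : add_lincat, is_zero Z;
  add_biproduct : forall X Y : add_lincat,
    exists W, inhabited (biproduct X Y W) }.

(* All subcategories are full, so the class of objects determines them; zero
   objects and binary direct sums account for all finite direct sums. *)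
Record subcat (k : fieldType) (L : lincat k) := SubCat {
  sub_ob :> L -> Prop;
  sub_iso : forall X Y (f : lhom X Y), is_iso f -> sub_ob X -> sub_ob Y;
  sub_zero : forall Z, is_zero Z -> sub_ob Z;
  sub_sum : forall X Y W, biproduct X Y W -> sub_ob X -> sub_ob Y -> sub_ob W }.

Section Quotient.
Variables (k : fieldType) (A : addcat k) (C : subcat A).

Definition factors_through (X Y : A) (f : lhom X Y) : Prop :=
  exists W (a : lhom X W) (b : lhom W Y), C W /\ f = b \oc a.

Lemma factors0 X Y : factors_through (0 : lhom X Y).
Proof.
have [Z Z0] := add_zero A.
exists Z, 0, 0; split; last by rewrite lcomp0m.
exact: sub_zero Z0.
Qed.

Lemma factorsP X Y c (f g : lhom X Y) :
  factors_through f -> factors_through g -> factors_through (c *: f + g).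
Proof.
move=> [W [a [b [CW ->]]]] [W' [a' [b' [CW' ->]]]].
have [S [s]] := add_biproduct W W'.
exists S, (bin1 s \oc (c *: a) + bin2 s \oc a'), (b \oc bpr1 s + b' \oc bpr2 s).
split; first exact: sub_sum s CW CW'.
rewrite lcompDl !lcompDr -!lcompA.
rewrite ![bpr1 s \oc (_ \oc _)]lcompA ![bpr2 s \oc (_ \oc _)]lcompA.
rewrite bpr1_in1 bpr2_in2 bpr2_in1 bpr1_in2 !lcomp1m !lcomp0m !lcompm0.
by rewrite add0r addr0 lcompZr.
Qed.

(* [C](X, Y); see mem_factor_space *)
Definition factor_space (X Y : A) : {vspace lhom X Y} :=
  pred_vspace (factors0 X Y) (@factorsP X Y).

Lemma mem_factor_space X Y (f : lhom X Y) :
  f \in factor_space X Y <-> factors_through f.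
Proof. exact: mem_pred_vspace. Qed.

Lemma factor_space_compl X Y Z (g : lhom Y Z) (f : lhom X Y) :
  f \in factor_space X Y -> g \oc f \in factor_space X Z.
Proof.
move/mem_factor_space=> [W [a [b [CW ->]]]]; apply/mem_factor_space.
by exists W, a, (g \oc b); rewrite lcompA.
Qed.

Lemma factor_space_compr X Y Z (g : lhom Y Z) (f : lhom X Y) :
  g \in factor_space Y Z -> g \oc f \in factor_space X Z.
Proof.
move/mem_factor_space=> [W [a [b [CW ->]]]]; apply/mem_factor_space.
by exists W, (a \oc f), b; rewrite lcompA.
Qed.

Definition qhom (X Y : A) : vectType k := quotv (factor_space X Y).

Definition qpi X Y (f : lhom X Y) : qhom X Y := quotv_pi _ f.

Definition qrepr X Y (q : qhom X Y) : lhom X Y := repr q.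

Definition qcomp X Y Z (q : qhom Y Z) (p : qhom X Y) : qhom X Z :=
  qpi (qrepr q \oc qrepr p).

Lemma qreprK X Y (q : qhom X Y) : qpi (qrepr q) = q.
Proof. exact: quotv_piK. Qed.

Lemma qpi_eq X Y (f g : lhom X Y) : qpi f = qpi g <-> factors_through (f - g).
Proof. by rewrite -mem_factor_space; apply: quotv_piE. Qed.

Lemma qpi_linear X Y : linear (@qpi X Y).
Proof. by move=> a f g; rewrite /qpi linearP. Qed.

Lemma qpi_comp X Y Z (g : lhom Y Z) (f : lhom X Y) :
  qpi (g \oc f) = qcomp (qpi g) (qpi f).
Proof.
apply/quotv_piE; set g' := qrepr _; set f' := qrepr _.
have -> : g \oc f - g' \oc f' = (g - g') \oc f + g' \oc (f - f').
  by rewrite lcompBl lcompBr addrA subrK.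
apply: memvD.
  by apply: factor_space_compr; apply/quotv_piE; rewrite quotv_piK.
by apply: factor_space_compl; apply/quotv_piE; rewrite quotv_piK.
Qed.

Lemma qcompA X Y Z T (h : qhom Z T) (g : qhom Y Z) (f : qhom X Y) :
  qcomp h (qcomp g f) = qcomp (qcomp h g) f.
Proof. by rewrite -(qreprK h) -(qreprK g) -(qreprK f) -!qpi_comp lcompA. Qed.

Lemma qcomp1m X Y (f : qhom X Y) : qcomp (qpi (lid Y)) f = f.
Proof. by rewrite -(qreprK f) -qpi_comp lcomp1m. Qed.

Lemma qcompm1 X Y (f : qhom X Y) : qcomp f (qpi (lid X)) = f.
Proof. by rewrite -(qreprK f) -qpi_comp lcompm1. Qed.

Lemma qcomp_linl X Y Z (f : qhom X Y) : linear (fun g : qhom Y Z => qcomp g f).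
Proof.
move=> a g h; rewrite -(qreprK f) -(qreprK g) -(qreprK h).
by rewrite -qpi_linear -!qpi_comp lcomp_linl qpi_linear.
Qed.

Lemma qcomp_linr X Y Z (g : qhom Y Z) : linear (fun f : qhom X Y => qcomp g f).
Proof.
move=> a f h; rewrite -(qreprK f) -(qreprK g) -(qreprK h).
by rewrite -qpi_linear -!qpi_comp lcomp_linr qpi_linear.
Qed.

(* A/[C] *)
Definition quotcat : lincat k :=
  LinCat qcompA qcomp1m qcompm1 qcomp_linl qcomp_linr.

End Quotient.

Definition lfull (k : fieldType) (L : lincat k) (P : L -> Prop) : lincat k :=
  @LinCat k {X : L | P X} (fun X Y => lhom (sval X) (sval Y))
    (fun X => lid (sval X)) (fun X Y Z g f => g \oc f)
    (fun X Y Z T h g f => lcompA h g f)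
    (fun X Y f => lcomp1m f) (fun X Y f => lcompm1 f)
    (fun X Y Z f => lcomp_linl f) (fun X Y Z g => lcomp_linr g).

Definition incl (k : fieldType) (L : lincat k) (P : L -> Prop) :
    functor (lfull P) L :=
  @Functor (lfull P) L (fun X => sval X) (fun X Y f => f)
    (fun _ => erefl) (fun _ _ _ _ _ => erefl).

(* mod k *)
Definition vectcat (k : fieldType) : category :=
  @Category (vectType k) (fun U V => 'Hom(U, V)) (fun U => \1%VF)
    (fun U V W g f => (g \o f)%VF)
    (fun U V W T h g f => comp_lfunA h g f)
    (fun U V f => comp_lfun1l f) (fun U V f => comp_lfun1r f).

Section Modules.
Variables (k : fieldType) (D : lincat k).

Definition vmap (A : functor (op D) (vectcat k)) (X Y : D) (f : lhom X Y) :
  'Hom(A Y, A X) := @fmap _ _ A Y X f.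

Definition additive_functor (A : functor (op D) (vectcat k)) : Prop :=
  forall (X Y : D) (f g : lhom X Y), vmap A (f + g) = vmap A f + vmap A g.


(* Mod D *)
Definition Modcat : category :=
  @full (funcat (op D) (vectcat k)) additive_functor.

Definition lcompr (X Y Z : D) (f : lhom X Y) (g : lhom Y Z) : lhom X Z := g \oc f.

HB.instance Definition _ (X Y Z : D) (f : lhom X Y) :=
  GRing.isLinear.Build k (lhom Y Z) (lhom X Z) _ (lcompr f) (lcomp_linl f).

HB.instance Definition _ (X Y Z : D) (g : lhom Y Z) :=
  GRing.isLinear.Build k (lhom X Y) (lhom X Z) _ (lcomp g) (lcomp_linr g).

Definition precomp (X Y Z : D) (f : lhom X Y) : 'Hom(lhom Y Z, lhom X Z) :=
  linfun (lcompr f).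

Lemma precompE (X Y Z : D) (f : lhom X Y) (g : lhom Y Z) : precomp Z f g = g \oc f.
Proof. exact: lfunE. Qed.

Definition postcomp (X Y Z : D) (g : lhom Y Z) : 'Hom(lhom X Y, lhom X Z) :=
  linfun (lcomp g).

Lemma postcompE (X Y Z : D) (g : lhom Y Z) (f : lhom X Y) : postcomp X g f = g \oc f.
Proof. exact: lfunE. Qed.

Lemma homfun1 (Z X : D) : precomp Z (lid X) = \1%VF.
Proof. by apply/lfunP=> f; rewrite precompE id_lfunE lcompm1. Qed.

Lemma homfunM (Z X Y W : D) (g : lhom Y X) (f : lhom W Y) :
  precomp Z (g \oc f) = (precomp Z f \o precomp Z g)%VF.
Proof. by apply/lfunP=> h; rewrite comp_lfunE !precompE lcompA. Qed.

Definition homfun (Z : D) : functor (op D) (vectcat k) :=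
  @Functor (op D) (vectcat k) (fun X => lhom X Z)
    (fun X Y f => precomp Z f) (homfun1 Z) (fun X Y W g f => homfunM Z f g).

Lemma homfun_additive Z : additive_functor (homfun Z).
Proof.
by move=> X Y f g; apply/lfunP=> h; rewrite add_lfunE !precompE lcompDr.
Qed.

Definition homfun_map_subproof Y Z (g : lhom Y Z) (X X' : op D)
    (f : hom X X') :
  comp (postcomp X' g : hom (homfun Y X') (homfun Z X')) (fmap (homfun Y) f) =
  comp (fmap (homfun Z) f) (postcomp X g : hom (homfun Y X) (homfun Z X)).
Proof.
by apply/lfunP=> h; rewrite !comp_lfunE /= !(precompE, postcompE) lcompA.
Qed.

Definition homfun_map Y Z (g : lhom Y Z) : nattrans (homfun Y) (homfun Z) :=
  NatTrans (homfun_map_subproof g).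

Definition yoneda (Z : D) : Modcat := exist _ (homfun Z) (@homfun_additive Z).

Definition ntcomp (A B : Modcat) (t : hom A B) (X : D) :
  'Hom(sval A X, sval B X) := (t : nattrans (sval A) (sval B)) X.

(* Exactness of A -> B -> C -> 0 in Mod D is checked at every object of D. *)
Definition right_exact (A B C : Modcat) (a : hom A B) (b : hom B C) : Prop :=
  forall X, limg (ntcomp a X) = lker (ntcomp b X) /\
            limg (ntcomp b X) = fullv.

Definition finitely_presented (A : Modcat) : Prop :=
  exists (D0 D1 : D) (a : hom (yoneda D1) (yoneda D0)) (b : hom (yoneda D0) A),
    right_exact a b.

(* mod D *)
Definition modcat : category := full finitely_presented.

End Modules.

Section ExactNotions.
Variables (k : fieldType) (L : lincat k).
Implicit Types X Y Z W : L.

Definition is_kernel X Y Z (i : lhom X Y) (p : lhom Y Z) : Prop :=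
  p \oc i = 0 /\
  forall W (f : lhom W Y), p \oc f = 0 -> exists! g : lhom W X, i \oc g = f.

Definition is_cokernel X Y Z (i : lhom X Y) (p : lhom Y Z) : Prop :=
  p \oc i = 0 /\
  forall W (f : lhom Y W), f \oc i = 0 -> exists! g : lhom Z W, g \oc p = f.

(* The square  i' \oc f = f' \oc i  is a pushout of i and f *)
Definition is_pushout X Y X' Y' (i : lhom X Y) (f : lhom X X')
    (i' : lhom X' Y') (f' : lhom Y Y') : Prop :=
  i' \oc f = f' \oc i /\
  forall W (u : lhom X' W) (v : lhom Y W), u \oc f = v \oc i ->
    exists! w : lhom Y' W, w \oc i' = u /\ w \oc f' = v.

(* The square  p \oc f' = f \oc p'  is a pullback of p and f *)
Definition is_pullback Y Z Y' Z' (p : lhom Y Z) (f : lhom Z' Z)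
    (p' : lhom Y' Z') (f' : lhom Y' Y) : Prop :=
  p \oc f' = f \oc p' /\
  forall W (u : lhom W Z') (v : lhom W Y), f \oc u = p \oc v ->
    exists! w : lhom W Y', p' \oc w = u /\ f' \oc w = v.

Variable E : forall X Y Z, lhom X Y -> lhom Y Z -> Prop.

Definition inflation_of X Y (i : lhom X Y) : Prop :=
  exists Z (p : lhom Y Z), E i p.

Definition deflation_of Y Z (p : lhom Y Z) : Prop :=
  exists X (i : lhom X Y), E i p.

(* Quillen's axioms, E being the class of short exact sequences; as usual the
   redundant ones are kept so that the list is self-dual. *)
Record exact_structure : Prop := ExactStructure {
  ses_kernel : forall X Y Z (i : lhom X Y) (p : lhom Y Z),
    E i p -> is_kernel i p;
  ses_cokernel : forall X Y Z (i : lhom X Y) (p : lhom Y Z),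
    E i p -> is_cokernel i p;
  ses_iso : forall X Y Z X' Y' Z' (i : lhom X Y) (p : lhom Y Z)
      (i' : lhom X' Y') (p' : lhom Y' Z')
      (a : lhom X X') (b : lhom Y Y') (c : lhom Z Z'),
    is_iso a -> is_iso b -> is_iso c ->
    i' \oc a = b \oc i -> p' \oc b = c \oc p -> E i p -> E i' p';
  inflation_id : forall X, inflation_of (lid X);
  deflation_id : forall X, deflation_of (lid X);
  inflation_comp : forall X Y Z (j : lhom Y Z) (i : lhom X Y),
    inflation_of i -> inflation_of j -> inflation_of (j \oc i);
  deflation_comp : forall X Y Z (q : lhom Y Z) (p : lhom X Y),
    deflation_of p -> deflation_of q -> deflation_of (q \oc p);
  inflation_pushout : forall X Y X' (i : lhom X Y) (f : lhom X X'),
    inflation_of i ->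
    exists Y' (i' : lhom X' Y') (f' : lhom Y Y'),
      is_pushout i f i' f' /\ inflation_of i';
  deflation_pullback : forall Y Z Z' (p : lhom Y Z) (f : lhom Z' Z),
    deflation_of p ->
    exists Y' (p' : lhom Y' Z') (f' : lhom Y' Y),
      is_pullback p f p' f' /\ deflation_of p' }.

End ExactNotions.

Record exactcat (k : fieldType) := ExactCat {
  exact_addcat :> addcat k;
  ses : forall X Y Z : exact_addcat, lhom X Y -> lhom Y Z -> Prop;
  sesP : exact_structure ses }.

Arguments ses {k e X Y Z} _ _.

Section ExactTheory.
Variables (k : fieldType) (B : exactcat k).
Implicit Types X Y Z W I P : B.

Definition injective_object I : Prop :=
  forall X Y Z (i : lhom X Y) (p : lhom Y Z), ses i p ->
  forall f : lhom X I, exists g : lhom Y I, g \oc i = f.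

Definition projective_object P : Prop :=
  forall X Y Z (i : lhom X Y) (p : lhom Y Z), ses i p ->
  forall f : lhom P Z, exists g : lhom P Y, p \oc g = f.

Definition enough_injectives : Prop :=
  forall X, exists I Z (i : lhom X I) (p : lhom I Z),
    injective_object I /\ ses i p.

Definition enough_projectives : Prop :=
  forall Z, exists X P (i : lhom X P) (p : lhom P Z),
    projective_object P /\ ses i p.

(* Equivalence of extensions of Z by X in the sense of Yoneda; f is then
   automatically an isomorphism. *)
Definition ext_equiv X Z Y Y' (i : lhom X Y) (p : lhom Y Z)
    (i' : lhom X Y') (p' : lhom Y' Z) : Prop :=
  exists f : lhom Y Y', f \oc i = i' /\ p' \oc f = p.

(* Ext^1(Z, X) is the group of equivalence classes of extensions of Z by X,
   whose zero is the class of the split extension. *)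
Definition Ext1_eq0 Z X : Prop :=
  forall Y (i : lhom X Y) (p : lhom Y Z), ses i p ->
  exists W (s : biproduct X Z W), ext_equiv i p (bin1 s) (bpr2 s).

Definition rigid (M : subcat B) : Prop :=
  forall X Y, M X -> M Y -> Ext1_eq0 X Y.

Lemma injective_iso X Y (f : lhom X Y) :
  is_iso f -> injective_object X -> injective_object Y.
Proof.
move=> [g [_ fg]] injX S T U i p ip h.
have [u uE] := injX _ _ _ _ _ ip (g \oc h).
by exists (f \oc u); rewrite -lcompA uE lcompA [_ \oc g]fg lcomp1m.
Qed.

Lemma injective_zero Z : is_zero Z -> injective_object Z.
Proof.
by move=> Z0 S T U i p ip h; exists 0; rewrite lcomp0m (proj1 (Z0 _) h).
Qed.

Lemma injective_sum X Y W : biproduct X Y W ->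
  injective_object X -> injective_object Y -> injective_object W.
Proof.
move=> s injX injY S T U i p ip h.
have [u uE] := injX _ _ _ _ _ ip (bpr1 s \oc h).
have [v vE] := injY _ _ _ _ _ ip (bpr2 s \oc h).
exists (bin1 s \oc u + bin2 s \oc v).
by rewrite lcompDl -!lcompA uE vE !lcompA -lcompDl bin_pr lcomp1m.
Qed.

Definition injectives : subcat B :=
  SubCat injective_iso injective_zero injective_sum.

Lemma iso_id X : is_iso (lid X).
Proof. by exists (lid X); split; apply: lcomp1m. Qed.

Lemma is_isoI X Y (f : lhom X Y) (g : lhom Y X) :
  g \oc f = lid X -> f \oc g = lid Y -> is_iso f.
Proof. by move=> gf fg; exists g; split. Qed.

Lemma ex_uniq (T : Type) (P : T -> Prop) (u v : T) :
  (exists! x, P x) -> P u -> P v -> u = v.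
Proof. by move=> [x [_ xU]] /xU <- /xU. Qed.

Lemma cokernel_iso X Y Z Z' (i : lhom X Y) (p : lhom Y Z) (p' : lhom Y Z') :
  is_cokernel i p -> is_cokernel i p' -> exists2 c, is_iso c & c \oc p = p'.
Proof.
move=> [pi0 pU] [pi0' pU'].
have [c [cE _]] := pU _ _ pi0'; have [d [dE _]] := pU' _ _ pi0.
exists c => //; apply: (is_isoI (g := d)).
  by apply: (ex_uniq (pU _ _ pi0)); rewrite ?lcomp1m // -lcompA cE dE.
by apply: (ex_uniq (pU' _ _ pi0')); rewrite ?lcomp1m // -lcompA dE cE.
Qed.

Lemma kernel_iso X X' Y Z (i : lhom X Y) (i' : lhom X' Y) (p : lhom Y Z) :
  is_kernel i p -> is_kernel i' p -> exists2 c, is_iso c & i' \oc c = i.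
Proof.
move=> [pi0 pU] [pi0' pU'].
have [c [cE _]] := pU' _ _ pi0; have [d [dE _]] := pU _ _ pi0'.
exists c => //; apply: (is_isoI (g := d)).
  by apply: (ex_uniq (pU _ _ pi0)); rewrite ?lcompm1 // lcompA dE cE.
by apply: (ex_uniq (pU' _ _ pi0')); rewrite ?lcompm1 // lcompA cE dE.
Qed.

Lemma inflation_cokernel X Y Z (i : lhom X Y) (p : lhom Y Z) :
  inflation_of (@ses k B) i -> is_cokernel i p -> ses i p.
Proof.
move=> [Z' [p' ip']] cp.
have [c ci cE] := cokernel_iso (ses_cokernel (sesP B) ip') cp.
apply: (ses_iso (sesP B) (iso_id X) (iso_id Y) ci) ip'.
  by rewrite lcompm1 lcomp1m.
by rewrite lcompm1 cE.
Qed.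

Lemma deflation_kernel X Y Z (i : lhom X Y) (p : lhom Y Z) :
  deflation_of (@ses k B) p -> is_kernel i p -> ses i p.
Proof.
move=> [X' [i' ip']] kp.
have [c ci cE] := kernel_iso (ses_kernel (sesP B) ip') kp.
apply: (ses_iso (sesP B) ci (iso_id Y) (iso_id Z)) ip'.
  by rewrite lcomp1m cE.
by rewrite lcompm1 lcomp1m.
Qed.

Lemma ses_epi X Y Z (i : lhom X Y) (p : lhom Y Z) W (u v : lhom Z W) :
  ses i p -> u \oc p = v \oc p -> u = v.
Proof.
move=> ip uv; have [pi0 pU] := ses_cokernel (sesP B) ip.
have v0 : (v \oc p) \oc i = 0 by rewrite -lcompA pi0 lcompm0.
exact: (ex_uniq (pU _ _ v0)).
Qed.

Lemma ses_mono X Y Z (i : lhom X Y) (p : lhom Y Z) W (u v : lhom W X) :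
  ses i p -> i \oc u = i \oc v -> u = v.
Proof.
move=> ip uv; have [pi0 pU] := ses_kernel (sesP B) ip.
have v0 : p \oc (i \oc v) = 0 by rewrite lcompA pi0 lcomp0m.
exact: (ex_uniq (pU _ _ v0)).
Qed.

Lemma pushout_iso X Y X' Y1 Y2 (i : lhom X Y) (f : lhom X X')
    (i1 : lhom X' Y1) (f1 : lhom Y Y1) (i2 : lhom X' Y2) (f2 : lhom Y Y2) :
  is_pushout i f i1 f1 -> is_pushout i f i2 f2 ->
  exists2 c, is_iso c & c \oc i1 = i2.
Proof.
move=> [s1 U1] [s2 U2].
have [c [[ci cf] _]] := U1 _ _ _ s2; have [d [[di df] _]] := U2 _ _ _ s1.
exists c => //; apply: (is_isoI (g := d)).
  apply: (ex_uniq (U1 _ _ _ s1)); rewrite ?lcomp1m // -!lcompA ci cf.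
  by rewrite di df.
apply: (ex_uniq (U2 _ _ _ s2)); rewrite ?lcomp1m // -!lcompA di df.
by rewrite ci cf.
Qed.

Lemma pushout_inflation X Y X' Y' (i : lhom X Y) (f : lhom X X')
    (i' : lhom X' Y') (f' : lhom Y Y') :
  is_pushout i f i' f' -> inflation_of (@ses k B) i ->
  inflation_of (@ses k B) i'.
Proof.
move=> po ii.
have [Y1 [i1 [f1 [po1 [Z [p ip]]]]]] := inflation_pushout (sesP B) f ii.
have [c ci cE] := pushout_iso po1 po.
have [d [dc cd]] : exists d, d \oc c = lid _ /\ c \oc d = lid _ := ci.
exists Z, (p \oc d).
apply: (ses_iso (sesP B) (iso_id _) ci (iso_id _)) ip.
  by rewrite lcompm1 cE.
by rewrite lcomp1m -lcompA dc lcompm1.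
Qed.

Section Biproducts.
Variables (X Y W : B) (s : biproduct X Y W).

Lemma bip_to T (u v : lhom T W) :
  bpr1 s \oc u = bpr1 s \oc v -> bpr2 s \oc u = bpr2 s \oc v -> u = v.
Proof.
move=> e1 e2; rewrite -[u]lcomp1m -[v]lcomp1m -(bin_pr s) !lcompDl -!lcompA.
by rewrite e1 e2.
Qed.

Lemma bip_from T (u v : lhom W T) :
  u \oc bin1 s = v \oc bin1 s -> u \oc bin2 s = v \oc bin2 s -> u = v.
Proof.
move=> e1 e2; rewrite -[u]lcompm1 -[v]lcompm1 -(bin_pr s) !lcompDr !lcompA.
by rewrite e1 e2.
Qed.

Definition bcopair T (u : lhom X T) (v : lhom Y T) : lhom W T :=
  u \oc bpr1 s + v \oc bpr2 s.

Lemma bcopair1 T (u : lhom X T) (v : lhom Y T) : bcopair u v \oc bin1 s = u.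
Proof.
by rewrite lcompDl -!lcompA bpr1_in1 bpr2_in1 lcompm0 lcompm1 addr0.
Qed.

Lemma bcopair2 T (u : lhom X T) (v : lhom Y T) : bcopair u v \oc bin2 s = v.
Proof.
by rewrite lcompDl -!lcompA bpr1_in2 bpr2_in2 lcompm0 lcompm1 add0r.
Qed.

Definition bip_sym : biproduct Y X W.
Proof.
refine (@Biproduct _ _ Y X W (bin2 s) (bin1 s) (bpr2 s) (bpr1 s) _ _ _ _ _).
- exact: bpr2_in2.
- exact: bpr1_in1.
- exact: bpr1_in2.
- exact: bpr2_in1.
- by rewrite addrC bin_pr.
Defined.

End Biproducts.

Lemma inflation_sum1 X Y T W W' (i : lhom X Y)
    (s : biproduct X T W) (s' : biproduct Y T W') :
  inflation_of (@ses k B) i ->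
  inflation_of (@ses k B) (bcopair s (bin1 s' \oc i) (bin2 s')).
Proof.
move=> ii; apply: (@pushout_inflation _ _ _ _ i (bin1 s) _ (bin1 s')) => //.
split; first by rewrite bcopair1.
move=> V u v uv; exists (bcopair s' v (u \oc bin2 s)); split.
  split; last exact: bcopair1.
  apply: (bip_from (s := s)).
    by rewrite -lcompA bcopair1 lcompA bcopair1 uv.
  by rewrite -lcompA !bcopair2.
move=> w [wu wv]; apply: (bip_from (s := s')); first by rewrite bcopair1.
by rewrite bcopair2 -wu -lcompA bcopair2.
Qed.

Lemma ses_sum X Y Z X' Y' Z' WX WY WZ (i : lhom X Y) (p : lhom Y Z)
    (i' : lhom X' Y') (p' : lhom Y' Z') (sX : biproduct X X' WX)
    (sY : biproduct Y Y' WY) (sZ : biproduct Z Z' WZ) :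
  ses i p -> ses i' p' ->
  ses (bcopair sX (bin1 sY \oc i) (bin2 sY \oc i'))
      (bcopair sY (bin1 sZ \oc p) (bin2 sZ \oc p')).
Proof.
move=> ip ip'.
have [pi0 pU] := ses_cokernel (sesP B) ip.
have [pi0' pU'] := ses_cokernel (sesP B) ip'.
apply: inflation_cokernel.
  have [V [sV]] := add_biproduct Y X'.
  have -> : bcopair sX (bin1 sY \oc i) (bin2 sY \oc i') =
     bcopair sV (bin1 sY) (bin2 sY \oc i')
       \oc bcopair sX (bin1 sV \oc i) (bin2 sV).
    apply: (bip_from (s := sX)); rewrite -lcompA.
      by rewrite !bcopair1 lcompA bcopair1.
    by rewrite !bcopair2.
  apply: (inflation_comp (sesP B)); first by apply: inflation_sum1; exists Z, p.
  have -> : bcopair sV (bin1 sY) (bin2 sY \oc i') =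
      bcopair (bip_sym sV) (bin1 (bip_sym sY) \oc i') (bin2 (bip_sym sY)).
    by rewrite /bcopair addrC.
  by apply: inflation_sum1; exists Z', p'.
split.
  apply: (bip_from (s := sX)); rewrite lcomp0m -lcompA.
    by rewrite bcopair1 lcompA bcopair1 -lcompA pi0 lcompm0.
  by rewrite bcopair2 lcompA bcopair2 -lcompA pi0' lcompm0.
move=> T f f0.
have f1 : (f \oc bin1 sY) \oc i = 0.
  by rewrite -lcompA -(bcopair1 sX (bin1 sY \oc i) (bin2 sY \oc i')) lcompA f0 lcomp0m.
have f2 : (f \oc bin2 sY) \oc i' = 0.
  by rewrite -lcompA -(bcopair2 sX (bin1 sY \oc i) (bin2 sY \oc i')) lcompA f0 lcomp0m.
have [u [uE uU]] := pU _ _ f1; have [v [vE vU]] := pU' _ _ f2.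
exists (bcopair sZ u v); split.
  apply: (bip_from (s := sY)); rewrite -lcompA.
    by rewrite bcopair1 lcompA bcopair1.
  by rewrite bcopair2 lcompA bcopair2.
move=> w wE; apply: (bip_from (s := sZ)).
  by rewrite bcopair1; apply: uU; rewrite -wE -!lcompA bcopair1.
by rewrite bcopair2; apply: vU; rewrite -wE -!lcompA bcopair2.
Qed.

Lemma ses_zero Z : is_zero Z -> ses (lid Z) (lid Z).
Proof.
move=> Z0; apply: inflation_cokernel; first exact: (inflation_id (sesP B)).
have z0 T (f : lhom Z T) : f = 0 by apply: (proj2 (Z0 T)).
split; first by rewrite (z0 _ (lid Z)) lcompm0.
move=> T f _; exists 0; split; first by rewrite lcomp0m (z0 _ f).
by move=> g _; rewrite (z0 _ g).
Qed.

Section RigidSubcategory.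
Variable M : subcat B.

Definition MR (Y : B) : Prop :=
  exists N1 N0 (i : lhom N1 N0) (p : lhom N0 Y), [/\ M N1, M N0 & ses i p].

Definition in_OmegaBar (X : B) : Prop :=
  exists N I (i : lhom N I) (p : lhom I X),
    [/\ M N, injectives I & ses i p].

Lemma OmegaBar_iso X Y (f : lhom X Y) :
  is_iso f -> in_OmegaBar X -> in_OmegaBar Y.
Proof.
move=> fi [N [I [i [p [MN II ip]]]]]; exists N, I, i, (f \oc p); split=> //.
apply: (ses_iso (sesP B) (iso_id _) (iso_id _) fi) ip.
  by rewrite lcompm1 lcomp1m.
by rewrite lcompm1.
Qed.

Lemma OmegaBar_zero Z : is_zero Z -> in_OmegaBar Z.
Proof.
move=> Z0; exists Z, Z, (lid Z), (lid Z); split; last exact: ses_zero.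
  exact: sub_zero Z0.
exact: sub_zero Z0.
Qed.

Lemma OmegaBar_sum X Y W : biproduct X Y W ->
  in_OmegaBar X -> in_OmegaBar Y -> in_OmegaBar W.
Proof.
move=> s [N [I [i [p [MN II ip]]]]] [N' [I' [i' [p' [MN' II' ip']]]]].
have [S [sS]] := add_biproduct N N'; have [J [sJ]] := add_biproduct I I'.
do 2!eexists; do 2!eexists; split; last exact: (ses_sum sS sJ s ip ip').
  exact: sub_sum sS MN MN'.
exact: sub_sum sJ II II'.
Qed.

Definition OmegaBar : subcat B :=
  SubCat OmegaBar_iso OmegaBar_zero OmegaBar_sum.

Definition costable : lincat k := quotcat injectives.

(* As M contains the injective objects, M/[I] is the full subcategory of B/[I]
   on the objects of M. *)
Definition Mbar : lincat k := @lfull k costable M.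

Definition cls (X Y : B) (f : lhom X Y) : @lhom k costable X Y :=
  qpi injectives f.

(* Morphisms to X in the costable category, restricted to Mbar *)
Definition Kfun (X : B) : functor (op Mbar) (vectcat k) :=
  compF (@homfun k costable X) (opF (@incl k costable M)).

Lemma Kfun_additive X : additive_functor (Kfun X).
Proof.
move=> N N' f g; exact: (@homfun_additive _ costable X (sval N) (sval N')).
Qed.

Definition Kob (X : B) : Modcat Mbar := exist _ (Kfun X) (@Kfun_additive X).

Lemma Kmap_subproof X Y (f : lhom X Y) (N N' : op Mbar) (g : hom N N') :
  comp (homfun_map (cls f) (sval N') : hom (Kfun X N') (Kfun Y N'))
       (fmap (Kfun X) g) =
  comp (fmap (Kfun Y) g) (homfun_map (cls f) (sval N)).
Proof. exact: (ntP (homfun_map (cls f))). Qed.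

Definition Kmap X Y (f : lhom X Y) : nattrans (Kfun X) (Kfun Y) :=
  NatTrans (Kmap_subproof f).

Lemma KmapE X Y (f : lhom X Y) (N : Mbar)
    (g : @lhom k costable (sval N) X) :
  (Kmap f N : 'Hom(@lhom k costable (sval N) X, @lhom k costable (sval N) Y)) g =
  @lcomp k costable _ _ _ (cls f) g.
Proof. exact: (@postcompE k costable). Qed.

Lemma Kmap_eq X Y (f g : lhom X Y) :
  (forall N (h : lhom N X), M N -> cls (f \oc h) = cls (g \oc h)) ->
  Kmap f = Kmap g.
Proof.
move=> fg; apply: nattrans_eq => -[N MN]; apply/lfunP => h.
rewrite (KmapE f (N := exist _ N MN)) (KmapE g (N := exist _ N MN)) /=.
rewrite -(qreprK h) /cls -!qpi_comp.
exact: fg.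
Qed.

Lemma Kmap1 X : Kmap (lid X) = idnt (Kfun X).
Proof.
apply: nattrans_eq => N; apply/lfunP => h; rewrite (KmapE _ (N := N)).
by rewrite id_lfunE; apply: (@lcomp1m k costable).
Qed.

Lemma KmapM X Y Z (g : lhom Y Z) (f : lhom X Y) :
  Kmap (g \oc f) = compnt (Kmap g) (Kmap f).
Proof.
apply: nattrans_eq => N; apply/lfunP => h; rewrite (KmapE _ (N := N)).
rewrite comp_lfunE /= (KmapE _ (N := N)) (KmapE _ (N := N)).
rewrite (@lcompA k costable); congr (lcomp _ h).
exact: (@qpi_comp k B injectives).
Qed.

Definition K : functor (@full B MR) (Modcat Mbar) :=
  @Functor (@full B MR) (Modcat Mbar)
    (fun S => Kob (sval S)) (fun S T f => Kmap f)
    (fun S => Kmap1 (sval S)) (fun S T U g f => KmapM g f).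

Hypothesis Mrigid : rigid M.
Hypothesis Minj : forall I : B, injectives I -> M I.

Lemma Ext1_lift Z X Y Z' (i : lhom X Y) (p : lhom Y Z') (f : lhom Z Z') :
  Ext1_eq0 Z X -> ses i p -> exists g : lhom Z Y, p \oc g = f.
Proof.
move=> E0 ip.
have pd : deflation_of (@ses k B) p by exists X, i.
have [Y' [p' [f' [[pE pU] p'd]]]] := deflation_pullback (sesP B) f pd.
have [pi0 iU] := ses_kernel (sesP B) ip.
have e0 : f \oc (0 : lhom X Z) = p \oc i by rewrite lcompm0 pi0.
have [j [[pj fj] _]] := pU _ _ _ e0.
have jp : ses j p'.
  apply: deflation_kernel => //; split=> // W u u0.
  have fu0 : p \oc (f' \oc u) = 0 by rewrite lcompA pE -lcompA u0 lcompm0.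
  have [v [vE vU]] := iU _ _ fu0.
  exists v; split; last by move=> w wE; apply: vU; rewrite -wE lcompA fj.
  have e1 : f \oc (0 : lhom W Z) = p \oc (f' \oc u) by rewrite lcompm0 fu0.
  apply: (ex_uniq (pU _ _ _ e1)); last by [].
  by rewrite !lcompA pj fj vE lcomp0m.
have [W [s [phi [phi1 phi2]]]] := E0 _ _ _ jp.
have [_ jU] := ses_cokernel (sesP B) jp.
have r0 : (lid Y' - j \oc (bpr1 s \oc phi)) \oc j = 0.
  by rewrite lcompBl lcomp1m -!lcompA phi1 bpr1_in1 lcompm1 subrr.
have [t [tE _]] := jU _ _ r0.
have pt : p' \oc t = lid Z.
  apply: (ses_epi jp); rewrite -lcompA tE lcompBr lcompm1 lcompA pj lcomp0m.
  by rewrite subr0 lcomp1m.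
by exists (f' \oc t); rewrite lcompA pE -lcompA pt lcompm1.
Qed.

Lemma Hom_OmegaBar N X (f : lhom N X) :
  M N -> OmegaBar X -> factors_through injectives f.
Proof.
move=> MN [N' [I [i [p [MN' II ip]]]]].
have [g gE] := Ext1_lift f (Mrigid MN MN') ip.
by exists I, g, p.
Qed.

Lemma K_OmegaBar X Y (f g : lhom X Y) :
  factors_through OmegaBar (f - g) -> Kmap f = Kmap g.
Proof.
move=> [W [a [b [OW fE]]]]; apply: Kmap_eq => N h MN.
apply/qpi_eq; rewrite -lcompBl fE -lcompA.
have [I [u [v [II ->]]]] := Hom_OmegaBar (a \oc h) MN OW.
by exists I, u, (b \oc v); rewrite lcompA.
Qed.

Section Presentation.
Variables (X : B) (N : B) (MN : M N) (p : lhom N X).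

Lemma Kyoneda_subproof (N1 N2 : op Mbar) (g : hom N1 N2) :
  comp (Kmap p N2 : hom (homfun (exist _ N MN : Mbar) N2) (Kfun X N2))
       (fmap (homfun (exist _ N MN : Mbar)) g) =
  comp (fmap (Kfun X) g) (Kmap p N1).
Proof. exact: (ntP (Kmap p)). Qed.

Definition Kyoneda : hom (yoneda (exist _ N MN : Mbar)) (Kob X) :=
  NatTrans Kyoneda_subproof.

Lemma KyonedaE (N' : Mbar) (g : @lhom k B (sval N') N) :
  ntcomp Kyoneda N' (cls g) = cls (p \oc g).
Proof.
by rewrite [LHS](KmapE _ (N := N')) /cls (@qpi_comp k B injectives).
Qed.

End Presentation.

Lemma K_fp X : MR X -> finitely_presented (Kob X).
Proof.
move=> [N1 [N0 [i [p [M1 M0 ip]]]]].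
have [pi0 iU] := ses_kernel (sesP B) ip.
pose D1 : Mbar := exist _ N1 M1; pose D0 : Mbar := exist _ N0 M0.
pose a : @lhom k Mbar D1 D0 := cls i.
exists D0, D1, (homfun_map a), (Kyoneda M0 p) => N.
have aE (h : @lhom k B (sval N) N1) :
    ntcomp (homfun_map a : hom (yoneda D1) (yoneda D0)) N (cls h) =
    cls (i \oc h).
  rewrite [LHS](@postcompE k Mbar N D1 D0 a (cls h)).
  by rewrite /cls (@qpi_comp k B injectives).
split; last first.
  apply/eqP; rewrite eqEsubv subvf /=; apply/subvP=> q _.
  have [g gE] := Ext1_lift (qrepr q) (Mrigid (svalP N) M1) ip.
  have -> : q = ntcomp (Kyoneda M0 p) N (cls g).
    by rewrite KyonedaE gE; apply: esym; apply: qreprK.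
  by apply: memv_img; apply: memvf.
apply/eqP; rewrite eqEsubv; apply/andP; split; apply/subvP=> q.
  case/memv_imgP=> r _ ->; rewrite memv_ker.
  have -> : r = cls (qrepr r) by apply: esym; apply: qreprK.
  rewrite aE KyonedaE lcompA pi0 lcomp0m.
  by apply/eqP; apply: (raddf0 (quotv_pi _)).
have {1 2}-> : q = cls (qrepr q) by apply: esym; apply: qreprK.
rewrite memv_ker KyonedaE => /eqP pq0.
have [I [u [v [II pE]]]] : factors_through injectives (p \oc qrepr q - 0).
  by apply/qpi_eq; rewrite [LHS]pq0; apply: esym; apply: (raddf0 (quotv_pi _)).
have [w wE] := Ext1_lift v (Mrigid (Minj II) M1) ip.
have g0 : p \oc (qrepr q - w \oc u) = 0.
  by rewrite lcompBr lcompA wE -pE subr0 subrr.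
have [h [hE _]] := iU _ _ g0.
have -> : cls (qrepr q) = cls (i \oc h).
  by apply/qpi_eq; rewrite hE opprB addrC subrK; exists I, u, w.
by rewrite -aE; apply: memv_img; apply: memvf.
Qed.

Lemma OmegaBar_MR X : OmegaBar X -> MR X.
Proof.
by move=> [N [I [i [p [MN II ip]]]]]; exists N, I, i, p; split; auto.
Qed.

(* M_R/[OmegaBar M], where OmegaBar M lies in M_R by OmegaBar_MR *)
Definition MRquot : category := @lfull k (quotcat OmegaBar) MR.

Definition MRproj : functor (@full B MR) MRquot :=
  @Functor (@full B MR) MRquot id (fun S T f => qpi OmegaBar f)
    (fun _ => erefl) (fun _ _ _ g f => qpi_comp OmegaBar g f).

Definition Gob (X : MRquot) : modcat Mbar :=
  exist _ (K X) (K_fp (svalP X)).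

Definition Gmap (X Y : MRquot) (q : hom X Y) : hom (Gob X) (Gob Y) :=
  Kmap (qrepr q).

(* G is induced by K: it composes with the projection to K *)
Lemma Gmap_proj (X Y : @full B MR) (f : hom X Y) :
  Gmap (fmap MRproj f) = fmap K f.
Proof. by apply: K_OmegaBar; apply/qpi_eq; apply: qreprK. Qed.

Lemma G1 (X : MRquot) : Gmap (idm X) = idm (Gob X).
Proof. exact: etrans (@Gmap_proj X X (@idm (@full B MR) X)) (fmap1 K X). Qed.

Lemma GM (X Y Z : MRquot) (q : hom Y Z) (r : hom X Y) :
  Gmap (comp q r) = comp (Gmap q) (Gmap r).
Proof.
exact: etrans (@Gmap_proj X Z (qrepr q \oc qrepr r))
  (@fmapM _ _ K X Y Z (qrepr q) (qrepr r)).
Qed.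

Definition G : functor MRquot (modcat Mbar) := Functor G1 GM.

End RigidSubcategory.
End ExactTheory.

(* Main.v *)
(* Fix a conflation N1 -i-> N0 -p-> X with N1, N0 in M. Since M is rigid, every
   morphism from an object of M to X lifts along p, so a morphism of functors
   KX -> KY is determined by the image of the class of p, represented by some
   q : N0 -> Y with q i factoring through an injective object. Extending along
   i and subtracting, one may assume q i = 0, so q factors through p and K is
   full.
   If K g = 0 then g p = v u with u : N0 -> I and I injective. For an inflation
   j : N0 -> J with J injective, u extends along j, and g factors through the
   cokernel of j i : N1 -> J, an object of OmegaBar M.
   Given f : N1 -> N0 in M and an inflation j : N1 -> I with I injective, (f, j)
   is an inflation N1 -> N0 + I, and K of its cokernel is presented by f because
   I vanishes in the costable category. *)

From mathcomp Require Import all_boot all_algebra.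
From mathcomp Require Import boolp.
Require Import Defs.

Set Implicit Arguments.
Unset Strict Implicit.
Unset Printing Implicit Defensive.

Import GRing.Theory.
Local Open Scope ring_scope.

(** * Equivalences from full, faithful and essentially surjective functors *)

Section FullyFaithful.
Variables (C D : category) (F : functor C D).

Definition faithful : Prop :=
  forall (X Y : C) (f g : hom X Y), fmap F f = fmap F g -> f = g.

Definition full_functor : Prop :=
  forall (X Y : C) (h : hom (F X) (F Y)), exists f, fmap F f = h.

Definition essentially_surjective : Prop :=
  forall Y : D, exists (X : C) (e : hom (F X) Y), isomorphism e.

Lemma isomorphism_of_map (X Y : C) (f : hom X Y) :
  faithful -> full_functor -> isomorphism (fmap F f) -> isomorphism f.
Proof.
move=> Ffaith Ffull [g' [gf fg]]; have [g gE] := Ffull _ _ g'.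
by exists g; split; apply: Ffaith; rewrite fmapM fmap1 gE.
Qed.

(** Choice picks preimages of objects and of morphisms; by faithfulness, every law of the
    quasi-inverse can be checked after applying [F]. *)
Lemma equivalence_of_fully_faithful :
  faithful -> full_functor -> essentially_surjective -> is_equivalence F.
Proof.
move=> Ffaith Ffull Fess.
pose H Y := sval (cid (Fess Y)).
pose e Y : hom (F (H Y)) Y := sval (cid (svalP (cid (Fess Y)))).
have eI Y : isomorphism (e Y) := svalP (cid (svalP (cid (Fess Y)))).
pose e' Y : hom Y (F (H Y)) := sval (cid (eI Y)).
have e'e Y : comp (e' Y) (e Y) = idm _ := (svalP (cid (eI Y))).1.
have ee' Y : comp (e Y) (e' Y) = idm _ := (svalP (cid (eI Y))).2.
pose pre X X' (h : hom (F X) (F X')) : hom X X' := sval (cid (Ffull _ _ h)).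
have preE X X' (h : hom (F X) (F X')) : fmap F (pre _ _ h) = h.
  exact: svalP (cid (Ffull _ _ h)).
pose Hm Y Y' (f : hom Y Y') : hom (H Y) (H Y') :=
  pre _ _ (comp (e' Y') (comp f (e Y))).
have FHm Y Y' (f : hom Y Y') :
  fmap F (Hm _ _ f) = comp (e' Y') (comp f (e Y)) by exact: preE.
have Hm1 Y : Hm _ _ (idm Y) = idm (H Y).
  by apply: Ffaith; rewrite FHm comp1m e'e fmap1.
have HmM X Y Z (g : hom Y Z) (f : hom X Y) :
    Hm _ _ (comp g f) = comp (Hm _ _ g) (Hm _ _ f).
  apply: Ffaith; rewrite fmapM !FHm -!compA; congr (comp _ (comp _ _)).
  by rewrite compA ee' comp1m.
pose HF : functor D C := Functor Hm1 HmM.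
exists HF; split.
  have etaP X Y (f : hom X Y) :
      comp (pre _ _ (e' (F Y))) (fmap (idF C) f) =
      comp (Hm _ _ (fmap F f)) (pre _ _ (e' (F X))).
    by apply: Ffaith; rewrite !fmapM !preE -!compA ee' compm1.
  exists (@NatTrans _ _ (idF C) (compF HF F) _ etaP) => X; apply: isomorphism_of_map => //=.
  by rewrite preE; exists (e (F X)).
have epsP X Y (f : hom X Y) :
    comp (e Y) (fmap F (Hm _ _ f)) = comp (fmap (idF D) f) (e X).
  by rewrite FHm compA ee' comp1m.
by exists (@NatTrans _ _ (compF F HF) (idF D) e epsP).
Qed.

End FullyFaithful.

(** * Cokernels in the functor category *)

Section RightExact.
Variables (k : fieldType) (D : lincat k).

Lemma ntcompP (A B : Modcat D) (t : hom A B) (X Y : D) (f : lhom Y X)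
    (q : sval A X) :
  ntcomp t Y (vmap (sval A) f q) = vmap (sval B) f (ntcomp t X q).
Proof.
have /lfunP/(_ q) := ntP (t : nattrans _ _) (f : @hom (op D) X Y).
by rewrite /= !comp_lfunE.
Qed.

(** The Yoneda argument: naturality of [a] along [h], evaluated at the identity of [D1]. *)
Lemma yonedaE (D0 D1 N : D) (a : hom (yoneda D1) (yoneda D0))
    (h : lhom N D1) :
  ntcomp a N h = (ntcomp a D1 (lid D1) : lhom D1 D0) \oc h.
Proof.
have := ntcompP a h (lid D1).
by rewrite /vmap /= !precompE lcomp1m.
Qed.

Variables (P Q A : Modcat D) (a : hom P Q) (b : hom Q A).
Hypothesis ab : right_exact a b.

Lemma right_exact_epi (T : Modcat D) (t t' : hom A T) :
  comp t b = comp t' b -> t = t'.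
Proof.
move=> tt'; apply: nattrans_eq => X; apply/lfunP => q.
have : q \in limg (ntcomp b X) by rewrite (ab X).2 memvf.
case/memv_imgP=> r _ ->.
have /(congr1 (fun s : nattrans _ _ => s X)) := tt'.
by move/lfunP => /(_ r); rewrite /= !comp_lfunE.
Qed.

Lemma right_exact_desc (T : Modcat D) (c : hom Q T) :
  (forall X, limg (ntcomp a X) <= lker (ntcomp c X))%VS ->
  exists t : hom A T, comp t b = c.
Proof.
move=> ac.
have [t tE] : exists t : forall X : D, 'Hom(sval A X, sval T X),
    forall X q, t X (ntcomp b X q) = ntcomp c X q.
  (* The choice of preimage under [b] does not matter: two of them differ by an element of the
     kernel of [b], which is the image of [a] and so is killed by [c]. *)
  exists (fun X => ntcomp c X \o (ntcomp b X)^-1)%VF => X q.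
  rewrite comp_lfunE; apply/eqP; rewrite -subr_eq0 -linearB -memv_ker.
  apply: (subvP (ac X)); rewrite (ab X).1 memv_ker linearB /=.
  by rewrite limg_lfunVK ?subrr // memv_img ?memvf.
have tP X Y (f : @hom (op D) X Y) :
    comp (t Y : @hom (vectcat k) _ _) (fmap (sval A) f) =
    comp (fmap (sval T) f) (t X).
  apply/lfunP => q.
  have : q \in limg (ntcomp b X) by rewrite (ab X).2 memvf.
  case/memv_imgP=> r _ ->; rewrite /= !comp_lfunE tE.
  by have /(congr1 (t Y)) := ntcompP b f r; rewrite tE ntcompP => ->.
exists (NatTrans tP : hom A T).
by apply: nattrans_eq => X; apply/lfunP => q; rewrite /= comp_lfunE tE.
Qed.

End RightExact.

Lemma right_exact_iso (k : fieldType) (D : lincat k) (P Q A A' : Modcat D)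
    (a : hom P Q) (b : hom Q A) (b' : hom Q A') :
  right_exact a b -> right_exact a b' -> exists t : hom A A', isomorphism t.
Proof.
move=> ab ab'.
have [t tE] : exists t, comp t b = b'.
  by apply: right_exact_desc ab _ _ _ => X; rewrite (ab' X).1.
have [s sE] : exists s, comp s b' = b.
  by apply: right_exact_desc ab' _ _ _ => X; rewrite (ab X).1.
exists t, s; split.
  by apply: (right_exact_epi ab); rewrite -compA tE sE comp1m.
by apply: (right_exact_epi ab'); rewrite -compA sE tE comp1m.
Qed.

(** * Fullness, kernel and image of [K] *)

Section Exact.
Variables (k : fieldType) (B : exactcat k).
Implicit Types X Y Z N I : B.

Lemma cls_eq0 X Y (f : lhom X Y) :
  cls f = 0 <-> factors_through (injectives B) f.
Proof.
have -> : 0 = cls (0 : lhom X Y) by apply/esym/(raddf0 (quotv_pi _)).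
by rewrite -[in X in _ <-> X](subr0 f); apply: qpi_eq.
Qed.

Lemma cls_comp X Y Z (g : lhom Y Z) (f : lhom X Y) :
  cls (g \oc f) = (cls g : @lhom k (costable B) Y Z) \oc cls f.
Proof. exact: qpi_comp. Qed.

Lemma clsP X Y (q : @lhom k (costable B) X Y) : exists f, q = cls f.
Proof. by exists (qrepr q); apply/esym/qreprK. Qed.

Lemma inflation_bin2 X Y W (s : biproduct X Y W) :
  inflation_of (@ses k B) (bin2 s).
Proof.
(* The zero inflation into [X] is the kernel of the deflation [lid X]. *)
have [Z [i [Z0 iP]]] : exists Z (i : lhom Z X),
    is_zero Z /\ inflation_of (@ses k B) i.
  have [Z [i iX]] := deflation_id (sesP B) X.
  have [i0 _] := ses_kernel (sesP B) iX; rewrite lcomp1m in i0.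
  exists Z, i; split; last by exists X, (lid X).
  have z1 : lid Z = 0 by apply: (ses_mono iX); rewrite i0 !lcomp0m.
  move=> T; split=> f; first by rewrite -[f]lcomp1m z1 lcomp0m.
  by rewrite -[f]lcompm1 z1 lcompm0.
have z1 : lid Z = 0 by apply: (proj1 (Z0 Z)).
have s1 : lid Y \oc lid Y = lid Y by rewrite lcomp1m.
have s3 : (0 : lhom Z Y) \oc 0 + lid Y \oc lid Y = lid Y.
  by rewrite lcomp0m add0r lcomp1m.
have s0 : (0 : lhom Y Z) \oc 0 = lid Z by rewrite z1 lcomp0m.
(* [Y] is itself a biproduct of the zero object [Z] and [Y]; under this identification [bin2 s] is
   the sum of [i] and the identity of [Y]. *)
pose s' := Biproduct s0 s1 (lcomp1m (0 : lhom Z Y)) (lcompm1 (0 : lhom Y Z)) s3.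
have := inflation_sum1 s' s iP.
by rewrite /bcopair /= lcompm0 add0r lcompm1.
Qed.

(* [(f, j)] is [(0, 1) : X -> Y + X] followed by the shear
   [(y, x) |-> (y + f x, x)] and by [id + j]. *)
Lemma inflation_pair X Y Z W (f : lhom X Y) (j : lhom X Z) (s : biproduct Y Z W) :
  inflation_of (@ses k B) j ->
  inflation_of (@ses k B) (bin1 s \oc f + bin2 s \oc j).
Proof.
move=> jP; have [V [v]] := add_biproduct Y X.
pose shear g := bcopair v (bin1 v) (bin1 v \oc g + bin2 v).
have shearK g h : g + h = 0 -> shear g \oc shear h = lid V.
  move=> gh; apply: (bip_from (s := v)); rewrite -lcompA.
    by rewrite !bcopair1 lcomp1m.
  rewrite bcopair2 lcompDr lcompA bcopair1 bcopair2 lcomp1m addrA.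
  by rewrite -lcompDr addrC [h + g]addrC gh lcompm0 addr0.
have [Z' [p vp]] := inflation_bin2 v.
have shearP : is_iso (shear f).
  by apply: (is_isoI (g := shear (- f))); apply: shearK; rewrite ?addNr ?subrr.
have e2 : inflation_of (@ses k B) (shear f \oc bin2 v).
  exists Z', (p \oc shear (- f)).
  apply: (ses_iso (sesP B) (iso_id X) shearP (iso_id Z')) vp.
    by rewrite lcompm1.
  by rewrite -lcompA shearK ?addNr // lcompm1 lcomp1m.
have e3 := inflation_sum1 (bip_sym v) (bip_sym s) jP.
have := inflation_comp (sesP B) e2 e3.
rewrite /shear bcopair2 lcompDr lcompA.
have -> : bin1 v = bin2 (bip_sym v) by [].
have -> : bin2 v = bin1 (bip_sym v) by [].
by rewrite bcopair1 bcopair2.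
Qed.

Variables (M : subcat B).
Hypotheses (M_rigid : rigid M) (M_inj : forall I : B, injectives B I -> M I).
Hypothesis B_inj : enough_injectives B.

Lemma Knat X Y (t : nattrans (Kfun M X) (Kfun M Y)) (N N' : Mbar M)
    (h : @lhom k B (sval N') (sval N)) (q : @lhom k B (sval N) X) :
  (t N' : 'Hom(@lhom k (costable B) _ X, @lhom k (costable B) _ Y))
    (cls (q \oc h)) =
  (t N : 'Hom(@lhom k (costable B) _ X, @lhom k (costable B) _ Y)) (cls q)
    \oc cls h.
Proof.
have := @ntcompP k (Mbar M) (Kob M X) (Kob M Y) t N N' (cls h) (cls q).
rewrite /vmap /= cls_comp.
by rewrite !(@precompE k (costable B)).
Qed.

Lemma K_full X Y (t : nattrans (Kfun M X) (Kfun M Y)) :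
  MR M X -> exists g : lhom X Y, Kmap M g = t.
Proof.
move=> [N1 [N0 [i [p [M1 M0 ip]]]]].
have [pi0 _] := ses_kernel (sesP B) ip; have [_ pU] := ses_cokernel (sesP B) ip.
pose D0 : Mbar M := exist _ N0 M0; pose D1 : Mbar M := exist _ N1 M1.
have [q qE] := clsP ((t D0 : 'Hom(@lhom k (costable B) N0 X,
                                  @lhom k (costable B) N0 Y)) (cls p)).
(* By naturality the class of [q \oc i] is the value of [t] at the class of [p \oc i], which is
   zero. *)
have [I [u [v [II vuE]]]] : factors_through (injectives B) (q \oc i).
  apply/cls_eq0; rewrite cls_comp -qE -(@Knat _ _ t D0 D1) pi0.
  by rewrite (cls_eq0 0).2 ?linear0 //; apply: factors0.
have [u' u'E] := II _ _ _ _ _ ip u.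
have q'0 : (q - v \oc u') \oc i = 0.
  by rewrite lcompBl -lcompA u'E vuE subrr.
have [g [gE _]] := pU _ _ q'0; exists g.
have gpE : cls (g \oc p) = cls q.
  apply/qpi_eq; rewrite gE addrC addKr -lcompNl.
  by exists I, u', (- v).
(* Every [h] from an object of [M] lifts along [p], so agreement at the class of [p] suffices. *)
apply: nattrans_eq => -[N MN]; apply/lfunP => h0.
have [h ->] := clsP h0; have [h' <-] := Ext1_lift h (M_rigid MN M1) ip.
rewrite (KmapE g (N := exist _ N MN)) (@Knat _ _ t D0 (exist _ N MN)) qE.
by rewrite -cls_comp lcompA cls_comp gpE.
Qed.

(** Phrased for one morphism in order to be applied to the difference of two representatives. *)
Lemma K_faithful X Y (g : lhom X Y) :
  MR M X -> (forall N (h : lhom N X), M N -> cls (g \oc h) = 0) ->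
  factors_through (OmegaBar M) g.
Proof.
move=> [N1 [N0 [i [p [M1 M0 ip]]]]] g0.
have [I [u [v [II vuE]]]] := (cls_eq0 _).1 (g0 _ p M0).
have [J [Z [j [r [JJ jr]]]]] := B_inj N0.
have [u' u'E] := II _ _ _ _ _ jr u.
(* The cokernel [C] of [j \oc i] is the middle object: [c \oc j] induces [a : X -> C] and [v \oc u']
   induces [w : C -> Y]. *)
have [C [c ic]] := inflation_comp (sesP B) (ex_intro _ _ (ex_intro _ _ ip) :
  inflation_of (@ses k B) i) (ex_intro _ _ (ex_intro _ _ jr)).
have [ci0 cU] := ses_cokernel (sesP B) ic.
have [pi0 pU] := ses_cokernel (sesP B) ip.
have cji0 : (c \oc j) \oc i = 0 by rewrite -lcompA.
have [a [aE _]] := pU _ _ cji0.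
have vu0 : (v \oc u') \oc (j \oc i) = 0.
  by rewrite lcompA -[_ \oc j]lcompA u'E -vuE -lcompA pi0 lcompm0.
have [w [wE _]] := cU _ _ vu0.
exists C, a, w; split; first by exists N1, J, (j \oc i), c.
apply: (ses_epi ip).
by rewrite -lcompA aE lcompA wE -lcompA u'E vuE.
Qed.

(** This gives essential surjectivity: a finitely presented functor is determined up to isomorphism
    by the map [a] presenting it. *)
Lemma K_presentation (D0 D1 : Mbar M) (a : hom (yoneda D1) (yoneda D0)) :
  exists X (b : hom (yoneda D0) (Kob M X)), MR M X /\ right_exact a b.
Proof.
case: D0 D1 a => [N0 M0] [N1 M1] a.
have [f fE] := clsP (ntcomp a (exist _ N1 M1) (lid _)).
have aE (N : Mbar M) (h : @lhom k B (sval N) N1) : ntcomp a N (cls h) = cls (f \oc h).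
  by rewrite yonedaE cls_comp -fE.
have [I [Z [j [r [II jr]]]]] := B_inj N1.
have [W [s]] := add_biproduct N0 I.
have [X [p ip]] := @inflation_pair _ _ _ _ f j s (ex_intro _ _ (ex_intro _ _ jr)).
have [pi0 iU] := ses_kernel (sesP B) ip.
have MW : M W := sub_sum s M0 (M_inj II).
exists X, (Kyoneda M0 (p \oc bin1 s)); split.
  by exists N1, W, (bin1 s \oc f + bin2 s \oc j), p.
move=> N; split; apply/eqP; rewrite eqEsubv ?subvf /=.
  apply/andP; split; apply/subvP=> q.
    case/memv_imgP=> h0 _ ->; have [h ->] := clsP h0.
    rewrite memv_ker aE (KyonedaE M0); apply/eqP/cls_eq0.
    (* Since [p] kills the pair [(f, j)], its restriction to [N0] composed with [f] is minus its
       restriction to [I] composed with [j]. *)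
    exists I, (j \oc h), (- (p \oc bin2 s)); split=> //.
    apply/eqP; rewrite -subr_eq0 lcompNl opprK !lcompA -lcompDl -!lcompA -lcompDr.
    by rewrite pi0 lcomp0m.
  have [h ->] := clsP q.
  rewrite memv_ker (KyonedaE M0) => /eqP/cls_eq0[J [u [v [JJ vuE]]]].
  (* The correction [w \oc u] passes through the injective [J]; once it is subtracted,
     [bin1 s \oc h] factors through [(f, j)], and the [N0] component shows that [h] is [f \oc t]
     modulo injectives. *)
  have [w wE] := Ext1_lift v (M_rigid (M_inj JJ) M1) ip.
  have hw0 : p \oc (bin1 s \oc h - w \oc u) = 0.
    by rewrite lcompBr !lcompA wE vuE subrr.
  have [t [tE _]] := iU _ _ hw0.
  have -> : cls h = ntcomp a N (cls t).
    rewrite aE; apply/qpi_eq; exists J, u, (bpr1 s \oc w); split=> //.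
    have /(congr1 (lcomp (bpr1 s))) := tE.
    rewrite lcompDl lcompDr lcompBr !lcompA bpr1_in1 bpr1_in2 !lcomp1m !lcomp0m addr0.
    by move=> ->; rewrite subKr.
  by rewrite memv_img ?memvf.
apply/subvP=> q _; have [h ->] := clsP q.
have [g <-] := Ext1_lift h (M_rigid (svalP N) M1) ip.
(* The component of [g] in [I] vanishes in the costable category, so only [bpr1 s \oc g] counts. *)
have -> : cls (p \oc g) =
    ntcomp (Kyoneda M0 (p \oc bin1 s)) N (cls (bpr1 s \oc g)).
  rewrite (KyonedaE M0); apply/qpi_eq; exists I, (bpr2 s \oc g), (p \oc bin2 s); split=> //.
  rewrite -!lcompA -lcompBr -[in X in X - _](lcomp1m g) -(bin_pr s) lcompDl -!lcompA.
  by rewrite addrC addKr.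
by rewrite memv_img ?memvf.
Qed.

End Exact.

Theorem theorem3p5 (k : fieldType) (B : exactcat k)
    (B_krull_schmidt : krull_schmidt B)
    (B_enough_projectives : enough_projectives B)
    (B_enough_injectives : enough_injectives B)
    (M : subcat B) (M_rigid : rigid M)
    (M_injectives : forall I : B, injectives B I -> M I) :
  is_equivalence (G M_rigid M_injectives).
Proof.
have GE (X Y : MRquot M) (f : @lhom k B (sval X) (sval Y)) :
    fmap (G M_rigid M_injectives) (qpi (OmegaBar M) f : hom X Y) = Kmap M f.
  exact: (@Gmap_proj _ _ _ M_rigid M_injectives X Y f).
apply: equivalence_of_fully_faithful.
- move=> X Y q q' Gqq'; rewrite -[q]qreprK -[q']qreprK.
  have Kff' : Kmap M (qrepr q) = Kmap M (qrepr q').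
    apply: etrans (esym (GE X Y _)) _; apply: etrans _ (GE X Y _).
    by rewrite !qreprK.
  apply/qpi_eq; apply: (K_faithful B_enough_injectives (svalP X)) => N h MN.
  have /lfunP/(_ (cls h)) :=
    congr1 (fun t : nattrans (Kfun M _) (Kfun M _) => t (exist _ N MN)) Kff'.
  rewrite /= (KmapE _ (N := exist _ N MN)) (KmapE _ (N := exist _ N MN)) -!cls_comp.
  by move/qpi_eq; rewrite -lcompBl => ?; apply/cls_eq0.
- move=> X Y t; have [g gE] := K_full M_rigid t (svalP X).
  by exists (qpi (OmegaBar M) g); apply: etrans (GE X Y g) gE.
(* [A] and the constructed [K X] are cokernels of the same [a], hence isomorphic. *)
move=> [A [D0 [D1 [a [b ab]]]]].
have [X [c [MX ac]]] := K_presentation M_rigid M_injectives B_enough_injectives a.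
by exists (exist _ X MX); apply: right_exact_iso ac ab.
Qed.
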